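(* For each $n$, let $G$ be a random graph on $n$ nodes drawn from the $1$K model with parameters $p_0,\dots,p_{n-1}$, and suppose that $p_i=p$ for all $i\in\{0,\dots,n-1\}$ (so that all $p_i$ equal $1/n$). Let $N$ denote the number of entries in the degree distribution of $G$ that are non-zero, i.e. $N=|\{k\in\{0,\dots,n-1\}: n_k(G)>0\}|$. Then, as $n\to\infty$, $$\mathbb{E}[N]=O\left(\sqrt{n\log n}\right).$$
   Context: $\mathcal{G}_n$ is the set of all simple undirected labelled graphs on $n$ nodes. For $g\in\mathcal{G}_n$, $n_k(g)$ is the number of nodes of $g$ of degree $k$. The $1$K model with parameters $p_0,\dots,p_{n-1}>0$, $\sum_{k=0}^{n-1}p_k=1$, is the probability distribution on $\mathcal{G}_n$ given by $\mathbb{P}(G=g)=\prod_{k=0}^{n-1}p_k^{n_k(g)}\big/\sum_{h\in\mathcal{G}_n}\prod_{k=0}^{n-1}p_k^{n_k(h)}$. *)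

(* Defs.v *)
From mathcomp Require Import all_boot all_order all_algebra.
From mathcomp Require Import all_classical all_reals all_analysis.

Set Implicit Arguments.
Unset Strict Implicit.
Unset Printing Implicit Defensive.

Import Order.TTheory GRing.Theory Num.Theory.
Import numFieldNormedType.Exports.

Local Open Scope classical_set_scope.
Local Open Scope ring_scope.

(* A simple labelled graph on 'I_n is its edge set, a set of unordered pairs
   of distinct nodes. *)
Definition is_edge_set (n : nat) (E : {set {set 'I_n}}) : bool :=
  [forall e in E, #|e| == 2%N].

Definition sgraph (n : nat) : Type := {E : {set {set 'I_n}} | is_edge_set E}.

Definition degree (n : nat) (g : sgraph n) (v : 'I_n) : nat :=
  #|[pred e in val g | v \in e]|.

Definition degree_count (n : nat) (g : sgraph n) (k : nat) : nat :=
  #|[pred v : 'I_n | degree g v == k]|.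

Definition num_degrees (n : nat) (g : sgraph n) : nat :=
  #|[pred k : 'I_n | (0 < degree_count g k)%N]|.

Definition oneK_weight (R : realType) (n : nat) (p : 'I_n -> R)
    (g : sgraph n) : R :=
  \prod_(k < n) p k ^+ degree_count g k.

Definition oneK_prob (R : realType) (n : nat) (p : 'I_n -> R)
    (g : sgraph n) : R :=
  oneK_weight p g / \sum_(h : sgraph n) oneK_weight p h.

(* As [sgraph n] is finite, measurability of the fibres of [G] amounts to
   measurability of [G] for the discrete sigma-algebra. *)
Definition oneK_random_graph (R : realType) (n : nat) (p : 'I_n -> R)
    (d : measure_display) (T : measurableType d) (P : probability T R)
    (G : T -> sgraph n) : Prop :=
  forall g : sgraph n,
    measurable (G @^-1` [set g]) /\ P (G @^-1` [set g]) = (oneK_prob p g)%:E.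

(* Main.v *)
Require Import Defs.
From mathcomp Require Import all_boot all_order all_algebra.
From mathcomp Require Import all_classical all_reals all_analysis.
From mathcomp Require Import measurable_realfun ring lra.

(* With equal parameters every graph has the same weight, because the degree
   counts sum to n; so G is uniform and each possible edge is present
   independently with probability 1/2. Hence 2 deg(v) - (n-1) is a sum of n-1
   independent signs, with E[exp(l (2 deg(v) - (n-1)))] = cosh(l)^(n-1), at most
   exp(2 n l^2) if l^2 <= 1/2. Degrees with |2k - (n-1)| < t contribute at most
   t to N, and the others at most the number of vertices with
   |2 deg(v) - (n-1)| >= t. For l = sqrt(log n / n) and t about
   3 sqrt(n log n), Chernoff's bound gives at most 2 such vertices on average. *)

Set Implicit Arguments.
Unset Strict Implicit.
Unset Printing Implicit Defensive.

Import Order.TTheory GRing.Theory Num.Theory.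
Import numFieldNormedType.Exports.

Local Open Scope classical_set_scope.
Local Open Scope ring_scope.

(** * Exponential moments of a vertex degree *)

Definition degree_bias (R : realType) (n : nat) (g : sgraph n) (v : 'I_n) : R :=
  (2 * degree g v)%:R - n.-1%:R.

Lemma card_incident_pairs (n : nat) (v : 'I_n) :
  #|[pred e : {set 'I_n} | (#|e| == 2%N) && (v \in e)]| = n.-1.
Proof.
pose pair_with (w : 'I_n) : {set 'I_n} := ([set v] :|: [set w])%SET.
have pair_inj : {in [set~ v]%SET &, injective pair_with}.
  move=> a b; rewrite !finset.inE => av bv /setP/(_ a).
  by rewrite /pair_with !finset.inE eqxx orbT (negPf av) /= => /esym/eqP.
rewrite -[n in RHS]card_ord -(cardsC1 v) -(card_in_imset pair_inj).
apply: eq_card => e; rewrite !inE; apply/andP/imsetP.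
  move=> [/eqP e2 ve].
  have /cards1P[w ew] : #|(e :\ v)%SET| == 1%N.
    by move: (cardsD1 v e); rewrite e2 ve => /eqP; rewrite eqSS eq_sym.
  exists w.
    by have := set11 w; rewrite -ew !finset.inE => /andP[].
  by rewrite /pair_with -ew finset.setD1K.
move=> [w]; rewrite !finset.inE => wv ->.
by rewrite /pair_with cards2 [v == w]eq_sym wv !finset.inE eqxx.
Qed.

(** Expanding the product by choosing, for each pair, present or absent yields one term per graph. A
    pair at [v] contributes [expR l] or [expR (- l)], any other pair 1 either way. *)
Lemma sum_expR_degree_bias (R : realType) (n : nat) (v : 'I_n) (l : R) :
  \sum_(g : sgraph n) expR (l * degree_bias R g v) =
  \prod_(e : {set 'I_n} | #|e| == 2%N)
    (if v \in e then expR l + expR (- l) else 2).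
Proof.
(* [F] weighs presence and [H] absence. Off the pairs they are 0 and 1, so every [E] containing a
   non-pair drops out of the expansion. *)
pose F (e : {set 'I_n}) : R :=
  if #|e| == 2%N then (if v \in e then expR l else 1) else 0.
pose H (e : {set 'I_n}) : R :=
  if (#|e| == 2%N) && (v \in e) then expR (- l) else 1.
have -> : \prod_(e : {set 'I_n} | #|e| == 2%N)
    (if v \in e then expR l + expR (- l) else 2) = \prod_e (F e + H e).
  rewrite [RHS](bigID (fun e : {set 'I_n} => #|e| == 2%N)) /=.
  rewrite [X in _ = _ * X]big1 ?mulr1.
    by apply: eq_bigr => e e2; rewrite /F /H e2 /=; case: ifP.
  by move=> e /negPf e2; rewrite /F /H e2 add0r.
rewrite bigA_distr (bigID (@is_edge_set n)) /=.
rewrite [X in _ = _ + X]big1 ?addr0; last first.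
  move=> E /forall_inPn[e eE e2].
  by rewrite (bigD1 e) //= eE /F (negPf e2) mul0r.
rewrite (big_sub (fun E => is_edge_set E)
  (fun E => \prod_e (if e \in E then F e else H e))).
apply: eq_bigr => -[E /= edgeE] _.
pose star := [pred e : {set 'I_n} | (#|e| == 2%N) && (v \in e)].
rewrite [RHS](bigID star) /= [X in _ = _ * X]big1 ?mulr1; last first.
  move=> e; rewrite /F /H; case: ifP => [eE|_ /negPf->//].
  by have /forall_inP/(_ _ eE) -> /= := edgeE; move=> /negPf ->.
have -> : l * degree_bias R (exist _ E edgeE) v =
    \sum_(e in star) (l * (e \in E)%:R * 2 - l).
  rewrite sumrB sumr_const card_incident_pairs -mulr_suml -mulr_sumr.
  rewrite /degree_bias natrM mulrBr -[l *+ _]mulr_natr -mulrA [_ * 2]mulrC.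
  congr (l * (2 * _) - _).
  rewrite -natr_sum; congr (_%:R).
  rewrite /degree -sum1_card /= [RHS]big_mkcond [LHS]big_mkcond /=.
  apply: eq_bigr => e _; rewrite !inE.
  case: (boolP (e \in E)) => [eE|_] /=; last by case: ifP.
  by have /forall_inP/(_ _ eE) -> /= := edgeE.
rewrite expR_sum; apply: eq_bigr => e /andP[e2 ve].
rewrite /F /H e2 ve /=; case: (e \in E); congr expR; rewrite /=; ring.
Qed.

(* Averaging [expR x <= 1 / (1 - x)] at [l] and [-l]: cosh l <= 1 / (1 - l^2). *)
Lemma addr_expRN_le (R : realType) (l : R) : l ^+ 2 <= 2^-1 ->
  expR l + expR (- l) <= 2 * expR (2 * l ^+ 2).
Proof.
move=> l2; have l_gtN1 : -1 < l by nra.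
have l_lt1 : l < 1 by nra.
have ab1 := expRxMexpNx_1 l; have a_ge := expR_ge1Dx l.
have b_ge := expR_ge1Dx (- l); have e_ge := expR_ge1Dx (2 * l ^+ 2).
have a_le : expR l * (1 - l) <= 1 by rewrite -[leRHS]ab1 ler_pM2l ?expR_gt0.
have b_le : expR (- l) * (1 + l) <= 1.
  by rewrite -[leRHS]ab1 [leRHS]mulrC ler_pM2l ?expR_gt0.
have u_gt0 : 0 < 1 - l ^+ 2 by lra.
rewrite -(ler_pM2r u_gt0); apply: (@le_trans _ _ 2).
  have -> : (expR l + expR (- l)) * (1 - l ^+ 2) =
    expR l * (1 - l) * (1 + l) + expR (- l) * (1 + l) * (1 - l) by ring.
  nra.
(* With u = l^2, (1 + 2u)(1 - u) = 1 + u(1 - 2u) is at least 1 because u is at most 1/2. *)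
have := sqr_ge0 l; nra.
Qed.

(** Only the n - 1 factors at [v] exceed 2, each by at most [expR (2 * l ^+ 2)]; as this is at least
    1, the exponent can be raised to n. *)
Lemma sum_expR_degree_bias_le (R : realType) (n : nat) (v : 'I_n) (l : R) :
  l ^+ 2 <= 2^-1 ->
  \sum_(g : sgraph n) expR (l * degree_bias R g v) <=
  #|{: sgraph n}|%:R * expR (2 * l ^+ 2 * n%:R).
Proof.
move=> l2; have -> : #|{: sgraph n}|%:R =
    \prod_(e : {set 'I_n} | #|e| == 2%N) 2 :> R.
  (* At l = 0 every summand is 1, so the identity counts the graphs. *)
  have := sum_expR_degree_bias v (0 : R).
  under eq_bigr do rewrite mul0r expR0.
  rewrite sumr_const => ->; apply: eq_bigr => e _.
  by rewrite oppr0 expR0; case: ifP => _ //; ring.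
rewrite sum_expR_degree_bias.
pose E : R := expR (2 * l ^+ 2).
apply: (@le_trans _ _ (\prod_(e : {set 'I_n} | #|e| == 2%N)
    (2 * (if v \in e then E else 1)))).
  apply: ler_prod => e _; case: ifP => _; last by rewrite mulr1 lexx ler0n.
  by rewrite addr_ge0 ?expR_ge0 //= addr_expRN_le.
rewrite big_split /= ler_wpM2l ?prodr_ge0 //.
rewrite -big_mkcondr prodr_const card_incident_pairs expRM_natr.
have E_ge1 : 1 <= E by rewrite /E -expR0 ler_expR mulr_ge0 ?sqr_ge0.
by rewrite ler_weXn2l // leq_pred.
Qed.

(** * Degrees near the mean and vertices far from it *)

(** Elements of [A] differ by less than t, so reduction modulo t is injective on [A]. *)
Lemma card_ord_spread (n t : nat) (A : {pred 'I_n}) :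
  {in A &, forall i j : 'I_n, (j < i + t)%N} -> (#|A| <= t)%N.
Proof.
case: t => [|t] At.
  rewrite leqn0; apply/eqP/eq_card0 => i; apply/negP => iA.
  by have := At i i iA iA; rewrite addn0 ltnn.
pose f (i : 'I_n) : 'I_t.+1 := inord (i %% t.+1).
suff f_inj : {in A &, injective f}.
  by rewrite -[t.+1]card_ord (leq_card_in f A f_inj).
move=> i j iA jA /(congr1 val); rewrite /f /= !inordK ?ltn_mod // => ij.
have ji := At i j iA jA; have {}At := At j i jA iA.
apply/val_inj => /=; move: ij ji At; move: (val i) (val j) => a b.
wlog ab : a b / (a <= b)%N => [wlog_ab | /esym/eqP ba lt_b _].
  by case: (leqP a b) => [|/ltnW] ab *; [|apply/esym]; apply: wlog_ab.
move: ba; rewrite eqn_mod_dvd //; case: (ltngtP a b) ab => // ab _.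
by rewrite gtnNdvd ?subn_gt0 // ltn_subLR // ltnW.
Qed.

Lemma degree_lt (n : nat) (g : sgraph n) (v : 'I_n) : (degree g v < n)%N.
Proof.
apply: leq_ltn_trans (_ : (n.-1 < n)%N); last by case: n v {g} => [[]|].
rewrite -(card_incident_pairs v); apply/subset_leq_card/fintype.subsetP => e.
rewrite !inE => /andP[eg ->]; rewrite andbT.
by have /forall_inP/(_ _ eg) := valP g.
Qed.

(** Near degrees have doubles in an open interval of length 2t, so they differ by less than t. Each
    far degree that occurs is the degree of some far vertex. *)
Lemma num_degrees_le (R : realType) (n : nat) (g : sgraph n) (t : nat) :
  (num_degrees g <= t + #|[pred v | (t%:R <= `|degree_bias R g v|)%R]|)%N.
Proof.
pose far := [pred v | t%:R <= `|degree_bias R g v|].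
pose near := [pred k : 'I_n | `|(2 * k)%:R - n.-1%:R| < (t%:R : R)].
(* The default [v] of [insubd] is never taken, by [degree_lt]. *)
pose f (v : 'I_n) : 'I_n := insubd v (degree g v).
rewrite /num_degrees -(cardID near) leq_add //.
  apply: leq_trans (_ : (#|near| <= t)%N).
    by apply/subset_leq_card/fintype.subsetP => k; rewrite !inE => /andP[].
  apply: card_ord_spread => i j; rewrite !inE !ltr_norml.
  move=> /andP[i1 _] /andP[_ j1]; rewrite -(ltr_nat R) natrD.
  by rewrite !natrM in i1 j1; lra.
apply: leq_trans (leq_imset_card f far).
apply/subset_leq_card/fintype.subsetP => k; rewrite !inE -leNgt.
move=> /andP[far_k /card_gt0P[v]]; rewrite inE => /eqP kv.
apply/imsetP; exists v; first by rewrite inE /degree_bias kv.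
by apply/val_inj; rewrite /f val_insubd degree_lt kv.
Qed.

(** Exponential Markov inequality: at a far vertex one of the two exponentials is at least
    [expR (l * t%:R)]. *)
Lemma card_degree_bias_ge (R : realType) (n : nat) (g : sgraph n)
    (t : nat) (l : R) :
  0 <= l ->
  #|[pred v | t%:R <= `|degree_bias R g v|]|%:R <=
  expR (- (l * t%:R)) * \sum_(v < n) (expR (l * degree_bias R g v) +
                                      expR (- l * degree_bias R g v)).
Proof.
move=> l0; rewrite -sum1_card natr_sum mulr_sumr big_mkcond /=.
apply: ler_sum => v _; rewrite mulrDr -!expRD; case: ifP => [|_]; last first.
  by rewrite addr_ge0 ?expR_ge0.
rewrite inE ler_normr => /orP[] ht; rewrite -[leLHS]expR0.
  by rewrite ler_wpDr ?expR_ge0 // ler_expR addrC subr_ge0 ler_wpM2l.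
by rewrite ler_wpDl ?expR_ge0 // ler_expR mulNr -mulrN addrC subr_ge0 ler_wpM2l.
Qed.

(** * Choice of parameters and the averaged bound *)

(** Squaring exp(x/4) >= 1 + x/4 suffices, as (1 + x/4)^2 = x + (1 - x/4)^2. This will secure l^2 <=
    1/2 for l^2 = log n / n. *)
Lemma ln_le_half (R : realType) (x : R) : 0 < x -> ln x <= x / 2.
Proof.
move=> x0; rewrite -ler_expR lnK ?posrE //.
have -> : x / 2 = x / 4 + x / 4 by field.
have := expR_ge1Dx (x / 4); rewrite expRD; move: (expR _) => e e_ge.
have : 0 <= (x / 4 - 1) ^+ 2 by rewrite sqr_ge0.
have : (1 + x / 4) * (1 + x / 4) <= e * e by rewrite ler_pM //; lra.
lra.
Qed.

Lemma sum_num_degrees_le (R : realType) (n : nat) : (1 < n)%N ->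
  \sum_(g : sgraph n) (num_degrees g)%:R <=
  #|{: sgraph n}|%:R * (6 * Num.sqrt (n%:R * ln n%:R)) :> R.
Proof.
move=> n1; set N : R := n%:R; set M : R := #|{: sgraph n}|%:R.
have N2 : 2 <= N by rewrite ler_nat.
have N0 : 0 < N by lra.
have lnN_le := ln_le_half N0.
(* From ln(1/N) <= 1/N - 1; it serves to get S >= 1. *)
have lnN_ge : 2^-1 <= ln N.
  have h : N^-1 <= 2^-1 by rewrite lef_pV2 ?posrE.
  have := @le_ln1Dx R (N^-1 - 1); rewrite [1 + _]addrC subrK lnV ?posrE //.
  have : 0 < N^-1 by rewrite invr_gt0.
  lra.
set L := ln N in lnN_le lnN_ge *; pose S := Num.sqrt (N * L).
have S2 : S ^+ 2 = N * L by rewrite sqr_sqrtr // mulr_ge0; lra.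
have S0 : 0 <= S by rewrite sqrtr_ge0.
have S1 : 1 <= S by nra.
pose l := S / N; pose t := (Num.truncn (3 * S)).+1.
have l0 : 0 <= l by rewrite divr_ge0 // ltW.
have lS : l * S = L by rewrite /l mulrAC -expr2 S2 mulrAC divff ?mul1r ?gt_eqF.
have l2N : l ^+ 2 * N = L.
  by rewrite expr2 -mulrA divfK ?gt_eqF.
have l2 : l ^+ 2 <= 2^-1 by rewrite -(ler_pM2r N0) l2N; lra.
have S3 : 0 <= 3 * S by lra.
have /andP[tS St] := truncn_itv S3.
have lt_ge : 3 * L <= l * t%:R.
  by rewrite -lS mulrCA; apply: ler_wpM2l => //; rewrite ltW.
(* The exponents add up to L + 2L - l t, which explains the factor 3 in [t]. *)
have tail_le : expR (- (l * t%:R)) * (N * expR (2 * l ^+ 2 * N)) <= 1.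
  rewrite -[X in X * expR _](@lnK R) ?posrE // -!expRD -mulrA l2N expR_le1.
  by rewrite -/L; lra.
(* Here t + 2 <= 3S + 3 <= 6S, since S >= 1. *)
apply: (@le_trans _ _ (M * (t%:R + 2))); last first.
  have tE : t%:R = (Num.truncn (3 * S))%:R + 1 :> R by rewrite natr1.
  by rewrite ler_wpM2l ?ler0n // -/S; lra.
apply: (@le_trans _ _ (\sum_(g : sgraph n) (t%:R +
    #|[pred v | t%:R <= `|degree_bias R g v|]|%:R))).
  by apply: ler_sum => g _; rewrite -natrD ler_nat num_degrees_le.
rewrite big_split /= sumr_const -[t%:R *+ _]mulr_natl mulrDr lerD2l.
apply: le_trans (ler_sum _ (fun g _ => card_degree_bias_ge g t l0)) _.
(* Summing over graphs first leaves, for each of n vertices and two signs, the moment bound;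
   [tail_le] then bounds the total by 2M. *)
rewrite -mulr_sumr exchange_big /=.
apply: (@le_trans _ _ (expR (- (l * t%:R)) *
    \sum_(v < n) (M * expR (2 * l ^+ 2 * N) * 2))).
  rewrite ler_wpM2l ?expR_ge0 //; apply: ler_sum => v _.
  rewrite big_split mulr_natr mulr2n lerD //=.
    exact: sum_expR_degree_bias_le.
  by rewrite -[l ^+ 2]sqrrN sum_expR_degree_bias_le // sqrrN.
rewrite sumr_const card_ord -[_ *+ n]mulr_natl -/N.
have M0 : 0 <= M * 2 by rewrite mulr_ge0 ?ler0n.
have := ler_wpM2l M0 tail_le; rewrite mulr1; apply: le_trans.
by rewrite le_eqVlt; apply/orP; left; apply/eqP; ring.
Qed.

(** * From the 1K model to the uniform distribution *)

Lemma sum_degree_count (n : nat) (g : sgraph n) :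
  (\sum_(k < n) degree_count g k = n)%N.
Proof.
rewrite -[RHS]card_ord -sum1_card.
rewrite [RHS](partition_big (fun v => Ordinal (degree_lt g v)) xpredT) //=.
apply: eq_bigr => k _; rewrite /degree_count -sum1_card.
by apply: eq_bigl => v; rewrite !inE.
Qed.

Lemma oneK_prob_const (R : realType) (n : nat) (p : 'I_n -> R) (q : R)
    (g : sgraph n) : 0 < q -> (forall i, p i = q) ->
  oneK_prob p g = #|{: sgraph n}|%:R^-1.
Proof.
move=> q0 pq; have weightE h : oneK_weight p h = q ^+ n.
  rewrite /oneK_weight; under eq_bigr do rewrite pq.
  by rewrite prodrXr sum_degree_count.
rewrite /oneK_prob (eq_bigr (fun=> q ^+ n)) // weightE sumr_const.
rewrite -[X in _ / X]mulr_natl invfM mulrCA divff ?mulr1 //.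
by rewrite expf_neq0 ?gt_eqF.
Qed.

(** [X \o G] is a finite combination of indicators of the fibres of [G]; nonnegativity lets the
    integral pass through the sum. *)
Lemma expectation_oneK (R : realType) (n : nat) (p : 'I_n -> R)
    (d : measure_display) (T : measurableType d) (P : probability T R)
    (G : T -> sgraph n) (X : sgraph n -> R) :
    oneK_random_graph p P G -> (forall g, 0 <= X g) ->
  ('E_P[X \o G])%E = (\sum_(g : sgraph n) X g * oneK_prob p g)%:E.
Proof.
move=> hG X0; rewrite unlock.
have XGE w : (X (G w))%:E =
    \sum_(g : sgraph n) ((X g)%:E * (\1_(G @^-1` [set g]) w)%:E)%E.
  rewrite (bigD1 (G w)) //= big1 ?adde0.
    by rewrite indicE mem_set //= mule1.
  move=> g gG; rewrite indicE memNset ?mule0 //= => Gg.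
  by rewrite Gg eqxx in gG.
under eq_integral => w _ do rewrite /= XGE.
have mG g : measurable (G @^-1` [set g]) by have [] := hG g.
rewrite ge0_integral_sum //; last first.
- by move=> g w _; rewrite mule_ge0 ?lee_fin.
- by move=> g; exact/measurable_funeM/measurable_EFinP/measurable_indic.
rewrite -sumEFin; apply: eq_bigr => g _.
rewrite ge0_integralZl ?lee_fin // ?integral_indic //.
- by rewrite setIT EFinM; congr (_ * _)%E; exact: (hG g).2.
- exact/measurable_EFinP/measurable_indic.
Qed.

Theorem proposition5 (R : realType) (p : forall n : nat, 'I_n -> R)
    (q : nat -> R)
    (p_gt0 : forall (n : nat) (i : 'I_n), 0 < p n i)
    (p_sum1 : forall n : nat, (0 < n)%N -> \sum_(i < n) p n i = 1)
    (p_const : forall (n : nat) (i : 'I_n), p n i = q n)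
    (d : nat -> measure_display) (T : forall n : nat, measurableType (d n))
    (P : forall n : nat, probability (T n) R)
    (G : forall n : nat, T n -> sgraph n)
    (hG : forall n : nat, (0 < n)%N -> oneK_random_graph (p n) (P n) (G n)) :
  (fun n : nat => fine ('E_(P n)[fun w => (num_degrees (G n w))%:R]))
    =O_\oo (fun n : nat => Num.sqrt (n%:R * ln n%:R) : R).
Proof.
apply/eqO_exP; exists 6 => //; near=> n.
have n1 : (1 < n)%N by near: n; exact: nbhs_infty_ge.
have n0 : (0 < n)%N by apply: ltnW.
have q0 : 0 < q n by rewrite -(p_const n (Ordinal n0)).
rewrite (expectation_oneK (X := fun g => (num_degrees g)%:R) (hG n n0)) //=.
under eq_bigr => g _ do rewrite (oneK_prob_const g q0 (p_const n)).
rewrite -mulr_suml ger0_norm; last first.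
  by rewrite mulr_ge0 ?invr_ge0 ?ler0n // sumr_ge0.
rewrite ger0_norm ?sqrtr_ge0 //.
(* The empty graph witnesses that the uniform normalisation is positive. *)
have card_gt0 : 0 < #|{: sgraph n}|%:R :> R.
  have no_edge : is_edge_set (n := n) finset.set0.
    by apply/forall_inP => e; rewrite finset.inE.
  rewrite ltr0n; apply/card_gt0P.
  by exists (exist (fun E => is_edge_set E) finset.set0 no_edge).
by rewrite ler_pdivrMr // mulrC sum_num_degrees_le.
Unshelve. all: by end_near.
Qed.
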